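(* Let $R=R(S,\kappa)$ be a near-integral fusion ring. There exist exactly two ring homomorphisms $\chi_\pm:R(S,\kappa)\to\mathbb{C}$ such that $\chi_\pm(\rho)\neq0$. In particular, $\chi_\pm|_S=\mathrm{FPdim}$ and $\chi_\pm(\rho)=d_\pm$.
   Context: A fusion ring $(R,B)$ is a unital associative ring $R$, free as a $\mathbb{Z}$-module with finite basis $B=\{1_R=b_1,\ldots,b_n\}$, such that $b_ib_j=\sum_k c_{ij}^kb_k$ with $c_{ij}^k\in\mathbb{Z}_{\geq0}$, together with an involution $\ast$ of $\{1,\ldots,n\}$ such that $\sum_ja_jb_j\mapsto\sum_ja_jb_{j^\ast}$ is an antiautomorphism of $R$ and $c_{ij}^1=1$ if $i=j^\ast$ and $0$ otherwise. $\mathrm{FPdim}:R\to\mathbb{C}$ is the ring homomorphism sending each $b_i\in B$ to the maximal real eigenvalue of $[c_{ij}^k]_{j,k}$, and $\mathrm{FPdim}(R):=\sum_{b\in B}\mathrm{FPdim}(b)^2$. A fusion subring is a fusion ring $(S,C)$ with $C\subseteq B$ and $S\subseteq R$ the $\mathbb{Z}$-span of $C$. $(R,B)$ is near-integral if it has a fusion subring $(S,C)$ with $|C|+1=|B|$. Then $\rho$ denotes the unique element of $B\setminus C$, $\kappa:=c_{\rho,\rho}^\rho\in\mathbb{Z}_{\geq0}$, $N:=\mathrm{FPdim}(S)$ (an integer), and $R$ is denoted $R(S,\kappa)$; its fusion rules are those of $S$ together with $x\rho=\rho x=\mathrm{FPdim}(x)\rho$ for $x\in C$ and $\rho^2=\kappa\rho+\sum_{x\in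 C}\mathrm{FPdim}(x)x$. $d_+:=\mathrm{FPdim}(\rho)$ is the positive root and $d_-$ the negative root of $x^2-\kappa x-N=0$. Ring homomorphisms are unital. *)

(* Defs.v *)
From HB Require Import structures.
From mathcomp Require Import all_boot all_order all_algebra.
From mathcomp Require Import complex.
From mathcomp Require Import boolp classical_sets reals.

Set Implicit Arguments.
Unset Strict Implicit.
Unset Printing Implicit Defensive.

Import Order.TTheory GRing.Theory Num.Theory.

Local Open Scope ring_scope.

(* [fr_prank] is n - 1, where n is the rank: the basis elements b_1 = 1, ..., b_n
   are indexed by 'I_fr_prank.+1, and the index 1 of the unit is ord0.
   [fr_coord] witnesses that the basis is a Z-basis. *)
Record fusionRing := FusionRing {
  fr_sort :> pzRingType;
  fr_prank : nat;
  fr_basis : 'I_fr_prank.+1 -> fr_sort;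
  fr_coord : fr_sort -> 'I_fr_prank.+1 -> int;
  fr_dual : 'I_fr_prank.+1 -> 'I_fr_prank.+1;
  fr_coordK : forall x, \sum_i fr_basis i *~ fr_coord x i = x;
  fr_coord_sum : forall (a : 'I_fr_prank.+1 -> int) j,
    fr_coord (\sum_i fr_basis i *~ a i) j = a j;
  fr_basis0 : fr_basis ord0 = 1;
  fr_coord_ge0 : forall i j k, 0 <= fr_coord (fr_basis i * fr_basis j) k;
  fr_dualK : involutive fr_dual;
  (* This map is additive and bijective by construction. *)
  fr_dualM : let star x := \sum_j fr_basis (fr_dual j) *~ fr_coord x j in
    forall x y, star (x * y) = star y * star x;
  fr_dual_coord0 : forall i j,
    fr_coord (fr_basis i * fr_basis j) ord0 = (i == fr_dual j)%:Z
}.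

(* c_{ij}^k *)
Definition fr_const (A : fusionRing) (i j k : 'I_(fr_prank A).+1) : int :=
  fr_coord (fr_basis i * fr_basis j) k.

Section FPdim.
Variables (K : realType) (A : fusionRing).

Definition fusion_mx (i : 'I_(fr_prank A).+1) : 'M[K]_((fr_prank A).+1) :=
  \matrix_(j, k) (fr_const i j k)%:~R.

(* The default value 0 is a junk value: fusion matrices, being nonnegative,
   have a largest real eigenvalue. *)
Definition max_real_eigenvalue n (M : 'M[K]_n) : K :=
  xget 0 [set a : K | eigenvalue M a /\
                      forall a' : K, eigenvalue M a' -> a' <= a]%classic.

Definition FPdim_basis (i : 'I_(fr_prank A).+1) : K :=
  max_real_eigenvalue (fusion_mx i).

(* The only additive map with the prescribed values on the basis. *)
Definition FPdim (x : A) : K[i] :=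
  \sum_i (FPdim_basis i)%:C%C *~ fr_coord x i.

Definition FPdim_ring : K := \sum_i FPdim_basis i ^+ 2.

End FPdim.

(* The inclusions of C in B and of S in R are represented by [fs_index] and
   [fs_incl]; injectivity of the latter follows from that of the former, and
   its image is the Z-span of the image of C. *)
Record fusionSubring (A : fusionRing) := FusionSubring {
  fs_ring :> fusionRing;
  fs_incl : {rmorphism fs_ring -> A};
  fs_index : 'I_(fr_prank fs_ring).+1 -> 'I_(fr_prank A).+1;
  fs_index_inj : injective fs_index;
  fs_inclE : forall i, fs_incl (fr_basis i) = fr_basis (fs_index i)
}.

Arguments fs_incl {A} f : rename.
Arguments fs_index {A} f i : rename.

(* A near-integral fusion ring R(S, kappa). *)
Record nearIntegralRing := NearIntegralRing {
  ni_ring :> fusionRing;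
  ni_sub : fusionSubring ni_ring;
  ni_rank : ((fr_prank ni_sub).+1 + 1 = (fr_prank ni_ring).+1)%N
}.

Section NearIntegral.
Variables (K : realType) (A : nearIntegralRing) (rho : 'I_(fr_prank A).+1).

(* rho is the index of the element of B \ C. *)
Definition is_rho : Prop := forall i, fs_index (ni_sub A) i != rho.

Definition kappa : int := fr_const rho rho rho.

Definition ni_N : K := FPdim_ring K (ni_sub A).

Definition d_plus : K := FPdim_basis K rho.

Definition d_minus : K :=
  xget 0 [set d : K | d < 0 /\ d ^+ 2 - kappa%:~R * d - ni_N = 0]%classic.

End NearIntegral.

(* Main.v *)
Require Import Defs.
From mathcomp Require Import all_boot all_order all_algebra.
From mathcomp Require Import complex.
From mathcomp Require Import reals.
From HB Require Import structures.
From mathcomp Require classical_sets.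
From mathcomp Require Import ring lra.

Local Open Scope ring_scope.

Import Order.TTheory GRing.Theory Num.Theory.

(* The coefficient of 1 is a trace on a fusion ring and b_k, b_{k*} are dual bases
   for it, so c_{ij}^k is the trace of b_i b_j b_{k*}. As C is closed under products
   and duality, this gives rho* = rho, b_i rho = rho b_i = m_i rho for b_i in C, and
   rho^2 = kappa rho + sum_i m_i b_i, with m_i > 0. A character nonzero at rho is
   therefore m on S and maps rho to a root of x^2 - kappa x - sum_i m_i^2; both
   roots occur. By Perron-Frobenius a character positive on the basis is FPdim;
   applied to the positive root this identifies m with FPdim on S and the root with
   FPdim(rho). *)

(** * Coordinates, the trace [c x ord0], and homomorphisms out of a fusion ring *)

Section FusionRingTheory.
Variable A : fusionRing.
Implicit Types (x y z : A) (i j k : 'I_(fr_prank A).+1).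
Local Notation b := (@fr_basis A).
Local Notation c := (@fr_coord A).

Lemma fr_coordD x y k : c (x + y) k = c x k + c y k.
Proof.
rewrite -[x in LHS]fr_coordK -[y in LHS]fr_coordK -big_split /=.
under eq_bigr do rewrite -mulrzDr.
exact: fr_coord_sum.
Qed.

Lemma fr_coord0 k : c 0 k = 0.
Proof. by apply: (addrI (c 0 k)); rewrite -fr_coordD !addr0. Qed.

Lemma fr_coordN x k : c (- x) k = - c x k.
Proof. by apply: (addrI (c x k)); rewrite -fr_coordD !subrr fr_coord0. Qed.

Lemma fr_coordB x y k : c (x - y) k = c x k - c y k.
Proof. by rewrite fr_coordD fr_coordN. Qed.

Lemma fr_coordMn x n k : c (x *+ n) k = c x k *+ n.
Proof. by elim: n => [|n IH]; rewrite ?mulr0n ?fr_coord0 // !mulrS fr_coordD IH. Qed.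

Lemma fr_coordMz x (a : int) k : c (x *~ a) k = c x k * a.
Proof.
case: a => n; first by rewrite -[x *~ _]/(x *+ n) fr_coordMn -mulrzz.
by rewrite -[x *~ _]/(x *- n.+1) fr_coordN fr_coordMn -mulrzz.
Qed.

Lemma fr_coord_bigsum I (r : seq I) (P : pred I) (F : I -> A) k :
  c (\sum_(i <- r | P i) F i) k = \sum_(i <- r | P i) c (F i) k.
Proof.
by apply: (big_morph (fun x => c x k)) => [x y|]; rewrite ?fr_coordD ?fr_coord0.
Qed.

Lemma fr_coord_basis i k : c (b i) k = (i == k)%:Z.
Proof.
rewrite -(fr_coord_sum (fun j => (i == j)%:Z) k); congr (c _ k).
rewrite (bigD1 i) //= eqxx mulr1z big1 ?addr0 // => j /negPf nj.
by rewrite eq_sym nj mulr0z.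
Qed.

Lemma fr_basis_inj : injective b.
Proof.
move=> i j e; have := fr_coord_basis i i.
by rewrite e fr_coord_basis eqxx; case: eqP => // ->.
Qed.

Lemma fr_coord_inj x y : (forall k, c x k = c y k) -> x = y.
Proof.
by move=> e; rewrite -[x]fr_coordK -[y]fr_coordK; apply: eq_bigr => i _; rewrite e.
Qed.

Lemma fr_coordMl x y k : c (x * y) k = \sum_i c x i * c (b i * y) k.
Proof.
rewrite -[x in LHS]fr_coordK mulr_suml fr_coord_bigsum; apply: eq_bigr => i _.
by rewrite mulrzAl fr_coordMz mulrC.
Qed.

Lemma fr_coordMr x y k : c (x * y) k = \sum_j c y j * c (x * b j) k.
Proof.
rewrite -[y in LHS]fr_coordK mulr_sumr fr_coord_bigsum; apply: eq_bigr => i _.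
by rewrite mulrzAr fr_coordMz mulrC.
Qed.

(** Expanding [x] in the basis, duality kills every term but [i = k]. This turns any structure
    constant into a trace. *)
Lemma fr_coord0_basisr x k : c (x * b (fr_dual k)) ord0 = c x k.
Proof.
rewrite fr_coordMl (bigD1 k) //= fr_dual_coord0 fr_dualK eqxx mulr1.
rewrite big1 ?addr0 // => i /negPf nik.
by rewrite fr_dual_coord0 fr_dualK nik mulr0.
Qed.

Lemma fr_coord0_basisl x k : c (b (fr_dual k) * x) ord0 = c x k.
Proof.
rewrite fr_coordMr (bigD1 k) //= fr_dual_coord0 eqxx mulr1.
rewrite big1 ?addr0 // => i /negPf nik.
by rewrite fr_dual_coord0 (inj_eq (can_inj (@fr_dualK A))) eq_sym nik mulr0.
Qed.

(** Expanding [x] in the basis, both sides become the sum of [c x i * c y (fr_dual i)]. *)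
Lemma fr_coord0_mulC x y : c (x * y) ord0 = c (y * x) ord0.
Proof.
rewrite fr_coordMl fr_coordMr; apply: eq_bigr => i _.
by rewrite -(@fr_dualK A i) fr_coord0_basisl fr_coord0_basisr.
Qed.

Lemma fr_rmorphE (R : pzRingType) (chi : {rmorphism A -> R}) x :
  chi x = \sum_i chi (b i) *~ c x i.
Proof.
by rewrite -[x in LHS]fr_coordK raddf_sum; apply: eq_bigr => i _; rewrite raddfMz.
Qed.

Lemma fr_rmorph_eq (R : pzRingType) (chi chi' : {rmorphism A -> R}) :
  (forall i, chi (b i) = chi' (b i)) -> chi =1 chi'.
Proof.
by move=> e x; rewrite !fr_rmorphE; apply: eq_bigr => i _; rewrite e.
Qed.

(** Characters are built by this lemma: by bilinearity, multiplicativity has to be checked on basis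
    elements only. *)
Lemma fr_rmorph_ext (R : comPzRingType) (v : 'I_(fr_prank A).+1 -> R) :
  v ord0 = 1 ->
  (forall i j, \sum_k v k *~ fr_const i j k = v i * v j) ->
  exists chi : {rmorphism A -> R}, forall i, chi (b i) = v i.
Proof.
move=> v0 vM; pose f x := \sum_i v i *~ c x i.
have fb i : f (b i) = v i.
  rewrite /f (bigD1 i) //= fr_coord_basis eqxx mulr1z big1 ?addr0 // => j.
  by rewrite fr_coord_basis eq_sym => /negPf ->; rewrite mulr0z.
have fB : zmod_morphism f.
  move=> x y; rewrite /f -sumrB; apply: eq_bigr => i _.
  by rewrite fr_coordB mulrzBr.
pose fA : {additive A -> R} := HB.pack f (GRing.isZmodMorphism.Build A R f fB).
have fM : monoid_morphism f.
  split; first by rewrite -fr_basis0 fb.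
  move=> x y; rewrite -[x in LHS]fr_coordK -[y in LHS]fr_coordK mulr_suml.
  rewrite -[f _]/(fA _) raddf_sum [f x]/f mulr_suml; apply: eq_bigr => i _.
  rewrite mulr_sumr raddf_sum [f y]/f mulr_sumr; apply: eq_bigr => j _.
  rewrite mulrzAl mulrzAr !raddfMz mulrzAl mulrzAr; congr (_ *~ _ *~ _).
  exact: vM.
pose fR : {rmorphism A -> R} :=
  HB.pack f fA (GRing.isMonoidMorphism.Build A R f fM).
by exists fR.
Qed.

End FusionRingTheory.

(** * Perron-Frobenius and the identification of FPdim *)

(* For a nonzero left eigenvector [w] of eigenvalue [a],
   [|a| |w| v <= |w| M v = l |w| v], and [|w| v > 0]. *)
Lemma max_real_eigenvalue_pos (K : realType) n (M : 'M[K]_n.+1) (v : 'I_n.+1 -> K)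
    (l : K) :
  (forall i j, 0 <= M i j) -> (forall i, 0 < v i) ->
  (forall i, \sum_j M i j * v j = l * v i) -> max_real_eigenvalue M = l.
Proof.
move=> M0 v0 Mv.
(* [eigenvalue] is about row vectors while [v] is a right eigenvector, so the link is singularity:
   were [M - l%:M] invertible, [v] would vanish. *)
have el : eigenvalue M l.
  rewrite /eigenvalue /eigenspace kermx_eq0 row_free_unit; apply/negP => u.
  have : (M - l%:M) *m (\col_i v i) = 0.
    apply/matrixP => i j; rewrite mulmxBl mul_scalar_mx !mxE.
    by under eq_bigr do rewrite !mxE; rewrite Mv subrr.
  move/(congr1 (mulmx (invmx (M - l%:M)))); rewrite mulKmx // mulmx0.
  move/matrixP/(_ ord0 ord0); rewrite !mxE => e.
  by have := v0 ord0; rewrite e ltxx.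
have max a : eigenvalue M a -> a <= l.
  case/eigenvalueP => w wM wn0; apply: le_trans (ler_norm a) _.
  have S0 : 0 < \sum_i `|w ord0 i| * v i.
    rewrite lt_neqAle eq_sym; apply/andP; split; last first.
      by apply: sumr_ge0 => i _; rewrite mulr_ge0 // ltW.
    apply: contraNN wn0 => /eqP S0; apply/eqP/matrixP => i j; rewrite !mxE ord1.
    have := @psumr_eq0P _ _ xpredT (fun i => `|w ord0 i| * v i).
    move=> /(_ (fun i _ => mulr_ge0 (normr_ge0 _) (ltW (v0 i))) S0 j isT) /eqP.
    by rewrite mulf_eq0 normr_eq0 (gt_eqF (v0 j)) orbF => /eqP.
  rewrite -(ler_pM2r S0) [leRHS]mulr_sumr.
  under [leRHS]eq_bigr do rewrite mulrCA -Mv mulr_sumr.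
  rewrite exchange_big mulr_sumr /=; apply: ler_sum => j _.
  under eq_bigr do rewrite mulrA.
  rewrite -mulr_suml mulrA ler_pM2r // -normrM.
  have -> : a * w ord0 j = \sum_i w ord0 i * M i j.
    by move/matrixP/(_ ord0 j): wM; rewrite !mxE.
  apply: le_trans (ler_norm_sum _ _ _) _; apply: ler_sum => i _.
  by rewrite normrM (ger0_norm (M0 _ _)).
apply: classical_sets.xget_unique => [|a [ea maxa]]; first by split.
by apply/eqP; rewrite eq_le max // maxa.
Qed.

(** Applying [chi] to the expansion of [b_i b_j] shows that the vector of values [chi b_j] is a
    positive eigenvector of [fusion_mx i] for [chi b_i]. *)
Lemma FPdim_basis_rmorph (K : realType) (A : fusionRing) (chi : {rmorphism A -> K}) :
  (forall i, 0 < chi (fr_basis i)) -> forall i, FPdim_basis K i = chi (fr_basis i).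
Proof.
move=> chi0 i; apply: (@max_real_eigenvalue_pos _ _ _ (fun j => chi (fr_basis j))) => //.
  by move=> j k; rewrite mxE ler0z fr_coord_ge0.
move=> j; rewrite -rmorphM [RHS]fr_rmorphE; apply: eq_bigr => k _.
by rewrite mxE mulrC mulrzr.
Qed.

Lemma FPdim_rmorph (K : realType) (A : fusionRing) (chi : {rmorphism A -> K}) :
  (forall i, 0 < chi (fr_basis i)) -> forall x, FPdim K x = (chi x)%:C%C.
Proof.
move=> chi0 x; rewrite fr_rmorphE raddf_sum; apply: eq_bigr => i _ /=.
by rewrite (FPdim_basis_rmorph _ _ chi) // raddfMz.
Qed.

Lemma quadratic_roots_opp_sign (K : rcfType) (k N : K) : 0 < N ->
  exists p q : K, [/\ 0 < p, q < 0, p + q = k & p * q = - N].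
Proof.
move=> N0; pose s := Num.sqrt (k ^+ 2 + 4 * N).
have s2 : s ^+ 2 = k ^+ 2 + 4 * N by rewrite sqr_sqrtr //; nra.
(* This bound on [k] is what gives [(k + s) / 2] and [(k - s) / 2] opposite signs. *)
have ks : `|k| < s.
  by rewrite -sqrtr_sqr ltr_sqrt; nra.
move: ks; rewrite ltr_norml => /andP[k1 k2].
exists ((k + s) / 2), ((k - s) / 2); split; [lra|lra|lra|nra].
Qed.

(** * Fusion rules of a near-integral ring *)

Section NearIntegralTheory.
Variables (A : nearIntegralRing) (rho : 'I_(fr_prank A).+1) (hrho : is_rho rho).
Implicit Types (i j k : 'I_(fr_prank A).+1).
Local Notation b := (@fr_basis A).
Local Notation c := (@fr_coord A).
Local Notation S := (ni_sub A).
Local Notation f := (fs_index S).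
Local Notation incl := (fs_incl S).
Local Notation m i := (fr_const i rho rho).

(** By counting: the image of the injective [f] avoids [rho] and has one element less than the
    basis. *)
Lemma fs_index_surj i : i != rho -> exists s, f s = i.
Proof.
move=> ni; have /setP/(_ i) : [set f s | s in [set: 'I__]] = [set~ rho].
  apply/eqP; rewrite eqEcard; apply/andP; split.
    by apply/subsetP => _ /imsetP[s _ ->]; rewrite !inE.
  rewrite card_imset ?cardsT ?cardsC1 ?card_ord; last exact: fs_index_inj.
  by have := ni_rank A; rewrite addn1 => -[<-].
by rewrite !inE ni => /imsetP[s _ ->]; exists s.
Qed.

Lemma fr_coord_incl (x : S) k :
  c (incl x) k = \sum_s fr_coord x s * (f s == k)%:Z.
Proof.
rewrite fr_rmorphE fr_coord_bigsum; apply: eq_bigr => s _.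
by rewrite fs_inclE fr_coordMz fr_coord_basis mulrC.
Qed.

Lemma fr_coord_incl_rho (x : S) : c (incl x) rho = 0.
Proof.
by rewrite fr_coord_incl big1 // => s _; rewrite (negPf (hrho s)) mulr0.
Qed.

Lemma fr_coord_incl_index (x : S) s : c (incl x) (f s) = fr_coord x s.
Proof.
rewrite fr_coord_incl (bigD1 s) //= eqxx mulr1 big1 ?addr0 // => t nt.
by rewrite (inj_eq (@fs_index_inj _ S)) (negPf nt) mulr0.
Qed.

Lemma fs_index0 : f ord0 = ord0.
Proof. by apply: fr_basis_inj; rewrite -fs_inclE !fr_basis0 rmorph1. Qed.

Lemma rho_neq0 : rho != ord0.
Proof. by rewrite -fs_index0 eq_sym. Qed.

(** The dual is detected by a unit coefficient equal to 1, and the inclusion preserves this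
    coefficient. *)
Lemma fs_index_dual s : fr_dual (f s) = f (fr_dual s).
Proof.
have : c (b (f (fr_dual s)) * b (f s)) ord0 = 1.
  by rewrite -!fs_inclE -rmorphM -fs_index0 fr_coord_incl_index fr_dual_coord0 eqxx.
by rewrite fr_dual_coord0; case: eqP => // ->.
Qed.

Lemma dual_rho : fr_dual rho = rho.
Proof.
have [//|/fs_index_surj[s e]] := eqVneq (fr_dual rho) rho.
have := hrho (fr_dual s).
by rewrite -fs_index_dual e fr_dualK eqxx.
Qed.

Lemma dual_neq_rho i : i != rho -> fr_dual i != rho.
Proof. by rewrite -{2}dual_rho (inj_eq (can_inj (@fr_dualK A))). Qed.

Lemma coord_mul_rho i j : i != rho -> j != rho -> c (b i * b j) rho = 0.
Proof.
move=> /fs_index_surj[s <-] /fs_index_surj[t <-].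
by rewrite -!fs_inclE -rmorphM fr_coord_incl_rho.
Qed.

(** For [k != rho], rotating the trace of [b_i rho b_{k*}] gives the coefficient of [rho] in
    [b_{k*} b_i], a product inside S. *)
Lemma basis_mul_rhol i : i != rho -> b i * b rho = b rho *~ m i.
Proof.
move=> ni; apply: fr_coord_inj => k; rewrite fr_coordMz fr_coord_basis.
have [<-|nk] := eqVneq rho k; first by rewrite mul1r.
rewrite mul0r -fr_coord0_basisr fr_coord0_mulC mulrA -{1}dual_rho fr_coord0_basisr.
by rewrite coord_mul_rho // dual_neq_rho // eq_sym.
Qed.

Lemma basis_mul_rhor i : i != rho -> b rho * b i = b rho *~ m i.
Proof.
move=> ni; apply: fr_coord_inj => k; rewrite fr_coordMz fr_coord_basis.
have [<-|nk] := eqVneq rho k.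
  (* Cyclicity of the trace of [rho b_i rho] gives the same multiplicity on both sides. *)
  rewrite mul1r -fr_coord0_basisr dual_rho fr_coord0_mulC mulrA fr_coord0_mulC.
  by rewrite mulrA -{2}dual_rho fr_coord0_basisr.
rewrite mul0r -fr_coord0_basisr -mulrA -{1}dual_rho fr_coord0_basisl.
by rewrite coord_mul_rho // dual_neq_rho // eq_sym.
Qed.

(** The antiautomorphism turns [b_i rho = m_i rho] into [rho b_{i*} = m_i rho]. *)
Lemma mult_rho_dual i : i != rho -> m (fr_dual i) = m i.
Proof.
move=> ni; have := fr_dualM (b i) (b rho); rewrite /= !basis_mul_rhol //.
have st j : \sum_k b (fr_dual k) *~ c (b j) k = b (fr_dual j).
  rewrite (bigD1 j) //= fr_coord_basis eqxx mulr1z big1 ?addr0 // => k.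
  by rewrite fr_coord_basis eq_sym => /negPf ->.
rewrite !st dual_rho basis_mul_rhor ?dual_neq_rho // => /(congr1 (c^~ rho)).
rewrite fr_coordMz fr_coord_basis eqxx mul1r => <-.
rewrite fr_coord_bigsum (bigD1 rho) //= dual_rho fr_coordMz fr_coord_basis eqxx.
rewrite fr_coordMz fr_coord_basis eqxx !mul1r big1 ?addr0 // => k nk.
by rewrite !fr_coordMz !fr_coord_basis [rho == k]eq_sym (negPf nk) mul0r mulr0.
Qed.

(** The trace of [rho rho b_{i*}] is, after rotation, the coefficient of [rho] in [b_{i*} rho]. *)
Lemma coord_rho_rho i : i != rho -> c (b rho * b rho) i = m i.
Proof.
move=> ni; rewrite -fr_coord0_basisr fr_coord0_mulC mulrA -{2}dual_rho.
by rewrite fr_coord0_basisr -mult_rho_dual.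
Qed.

Lemma mult_rho0 : m ord0 = 1.
Proof. by rewrite /fr_const fr_basis0 mul1r fr_coord_basis eqxx. Qed.

(** If [m i = 0], then [b_{i*} b_i rho = 0]; but [b_{i*} b_i] contains 1 and has nonnegative
    coefficients, so [rho] occurs in this product. *)
Lemma mult_rho_gt0 i : i != rho -> 0 < m i.
Proof.
move=> ni; rewrite lt_neqAle fr_coord_ge0 andbT eq_sym; apply/negP => /eqP mi0.
have : c (b (fr_dual i) * b i * b rho) rho = 0.
  by rewrite -mulrA basis_mul_rhol // mi0 mulr0z mulr0 fr_coord0.
rewrite fr_coordMl (bigD1 ord0) //= fr_dual_coord0 eqxx mul1r -/(fr_const _ _ _).
rewrite mult_rho0 => e.
have : 0 <= \sum_(k | k != ord0) c (b (fr_dual i) * b i) k * c (b k * b rho) rho.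
  by apply: sumr_ge0 => k _; rewrite mulr_ge0 ?fr_coord_ge0.
by rewrite -(lerD2l 1) e.
Qed.

(** * Characters that do not vanish at [rho] *)

Definition ni_Nz : int := \sum_(i | i != rho) m i ^+ 2.

Lemma ni_Nz_gt0 : 0 < ni_Nz.
Proof.
rewrite /ni_Nz (bigD1 ord0) /=; last by rewrite eq_sym rho_neq0.
rewrite mult_rho0 ltr_pwDl // sumr_ge0 // => i _; exact: sqr_ge0.
Qed.

(** Apply [chi] to [b_i rho = m_i rho] and cancel [chi rho] in the domain. *)
Lemma rmorph_basis_neq_rho (R : idomainType) (chi : {rmorphism A -> R}) :
  chi (b rho) != 0 -> forall i, i != rho -> chi (b i) = (m i)%:~R.
Proof.
move=> chi0 i ni; apply: (mulIf chi0).
by rewrite -rmorphM basis_mul_rhol // raddfMz mulrzl.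
Qed.

Lemma rmorph_rho (R : idomainType) (chi : {rmorphism A -> R}) :
  chi (b rho) != 0 ->
  chi (b rho) ^+ 2 = (kappa rho)%:~R * chi (b rho) + ni_Nz%:~R.
Proof.
move=> chi0; rewrite expr2 -rmorphM fr_rmorphE (bigD1 rho) //= mulrzl; congr (_ + _).
rewrite /ni_Nz rmorph_sum; apply: eq_bigr => i ni.
by rewrite rmorph_basis_neq_rho // coord_rho_rho // -mulrzr -rmorphM.
Qed.

Lemma exists_rmorph_rho (R : comPzRingType) (d : R) :
  d ^+ 2 = (kappa rho)%:~R * d + ni_Nz%:~R ->
  exists chi : {rmorphism A -> R}, chi (b rho) = d /\
    forall i, i != rho -> chi (b i) = (m i)%:~R.
Proof.
move=> d2; pose v i : R := if i == rho then d else (m i)%:~R.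
case: (@fr_rmorph_ext _ R v); last first.
- move=> chi chiE; exists chi; split; first by rewrite chiE /v eqxx.
  by move=> i /negPf ni; rewrite chiE /v ni.
- move=> i j; rewrite (bigD1 rho) //= {1}/v eqxx.
  have vE : forall k, k != rho -> v k = (m k)%:~R by rewrite /v => k /negPf ->.
  have vr : v rho = d by rewrite /v eqxx.
  (* Only the case [i = j = rho] uses the quadratic equation; the mixed cases are the absorption
     rules. *)
  have [ei|ni] := eqVneq i rho; have [ej|nj] := eqVneq j rho.
  + rewrite ei ej vr -expr2 d2 mulrzl; congr (_ + _).
    rewrite /ni_Nz rmorph_sum; apply: eq_bigr => k nk.
    by rewrite vE // /fr_const coord_rho_rho // -mulrzr -rmorphM.
  + rewrite ei vr vE // /fr_const basis_mul_rhor // fr_coordMz fr_coord_basis eqxx.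
    rewrite mul1r mulrzr big1 ?addr0 // => k nk.
    by rewrite fr_coordMz fr_coord_basis eq_sym (negPf nk) mul0r mulr0z.
  + rewrite ej vr vE // {1}/fr_const basis_mul_rhol // fr_coordMz fr_coord_basis eqxx.
    rewrite mul1r mulrzl big1 ?addr0 // => k nk.
    rewrite /fr_const basis_mul_rhol // fr_coordMz fr_coord_basis eq_sym.
    by rewrite (negPf nk) mul0r mulr0z.
  + rewrite !vE // /fr_const coord_mul_rho // mulr0z add0r -rmorphM.
    (* Multiplicativity of [m] on C: both sides compute the coefficient of [rho] in
       [b_i b_j rho]. *)
    have -> : c (b i * b rho) rho * c (b j * b rho) rho
              = \sum_k c (b i * b j) k * c (b k * b rho) rho.
      rewrite -fr_coordMl -mulrA (basis_mul_rhol j) // mulrzAr fr_coordMz.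
      by rewrite fr_coord_basis eqxx mul1r fr_coordMz.
    rewrite [\sum_k _](bigD1 rho) //= coord_mul_rho // mul0r add0r rmorph_sum.
    by apply: eq_bigr => k nk; rewrite vE // -mulrzr -rmorphM mulrC.
- by rewrite /v eq_sym (negPf rho_neq0) mult_rho0.
Qed.

(** The restriction of [chi] to S is positive on C, hence gives the dimensions there; [f] then
    reindexes the sum. *)
Lemma ni_N_Nz (K : realType) (chi : {rmorphism A -> K}) :
  (forall i, 0 < chi (b i)) -> (forall i, i != rho -> chi (b i) = (m i)%:~R) ->
  ni_N K A = ni_Nz%:~R.
Proof.
move=> chi0 chiE; rewrite /ni_N /FPdim_ring /ni_Nz rmorph_sum /=.
have FE s : FPdim_basis K s = (m (f s))%:~R.
  rewrite (@FPdim_basis_rmorph _ _ (chi \o incl : {rmorphism _ -> _})) /=.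
    by rewrite fs_inclE chiE.
  by move=> t; rewrite fs_inclE.
have -> : \sum_(i | i != rho) ((m i ^+ 2)%:~R : K) =
          \sum_(i in [set f s | s in [set: 'I__]]) (m i ^+ 2)%:~R.
  apply: eq_bigl => i; apply/idP/imsetP => [/fs_index_surj[s <-]|[s _ ->]] //.
  by exists s.
rewrite big_imset /=; last by move=> s t _ _; apply: fs_index_inj.
by apply: eq_big => [s|s _]; rewrite ?inE // FE rmorphXn.
Qed.

End NearIntegralTheory.

(** * The two characters and their uniqueness *)

Theorem proposition3p3 (K : realType) (A : nearIntegralRing)
    (rho : 'I_(fr_prank A).+1) (hrho : is_rho rho) :
  exists chi_plus chi_minus : {rmorphism A -> K[i]},
    [/\ chi_plus (fr_basis rho) <> 0 /\ chi_minus (fr_basis rho) <> 0,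
        ~ (chi_plus =1 chi_minus),
        (forall chi : {rmorphism A -> K[i]}, chi (fr_basis rho) <> 0 ->
           chi =1 chi_plus \/ chi =1 chi_minus),
        (forall s : ni_sub A,
           chi_plus (fs_incl (ni_sub A) s) = FPdim K s /\
           chi_minus (fs_incl (ni_sub A) s) = FPdim K s) &
        chi_plus (fr_basis rho) = (d_plus K rho)%:C%C /\
        chi_minus (fr_basis rho) = (d_minus K rho)%:C%C].
Proof.
have N0 : 0 < (ni_Nz A rho)%:~R :> K by rewrite ltr0z ni_Nz_gt0.
have [p [q [p0 q0 pq pqN]]] := @quadratic_roots_opp_sign K (kappa rho)%:~R _ N0.
(* [P] and [Q] are built over the ordered field [K], where positivity and FPdim make sense, and are
   embedded in [K[i]] afterwards. *)
have [|P [Pr Pi]] := @exists_rmorph_rho A rho hrho K p; first by nra.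
have [|Q [Qr Qi]] := @exists_rmorph_rho A rho hrho K q; first by nra.
have Pgt0 i : 0 < P (fr_basis i).
  have [->|ni] := eqVneq i rho; first by rewrite Pr.
  by rewrite Pi // ltr0z mult_rho_gt0.
have FS s : FPdim K s = (P (fs_incl (ni_sub A) s))%:C%C.
  rewrite (@FPdim_rmorph _ _ (P \o fs_incl (ni_sub A) : {rmorphism _ -> _})) //.
  by move=> t /=; rewrite fs_inclE.
(* [Q] is negative at [rho], so Perron-Frobenius does not apply to it; on S it agrees with [P]. *)
have QS s : Q (fs_incl (ni_sub A) s) = P (fs_incl (ni_sub A) s).
  apply: (@fr_rmorph_eq _ _ (Q \o fs_incl (ni_sub A) : {rmorphism _ -> _})
                            (P \o fs_incl (ni_sub A) : {rmorphism _ -> _})) => t /=.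
  by rewrite fs_inclE Qi ?Pi.
exists (real_complex K \o P : {rmorphism _ -> _}).
exists (real_complex K \o Q : {rmorphism _ -> _}).
have C0 (x : K) : x != 0 -> x%:C%C <> 0 :> K[i]
  by move=> x0; apply/eqP; rewrite fmorph_eq0.
split => /=.
- by rewrite Pr Qr; split; apply: C0; [exact: lt0r_neq0 | exact: ltr0_neq0].
- by move/(_ (fr_basis rho)) => /=; rewrite Pr Qr => /fmorph_inj e; lra.
- move=> chi /eqP chi0; have chii := @rmorph_basis_neq_rho _ _ hrho _ _ chi0.
  (* With [kappa = p + q] and [N = - p q], the quadratic equation for [chi rho] factors. *)
  have : (chi (fr_basis rho) - p%:C%C) * (chi (fr_basis rho) - q%:C%C) = 0.
    have := @rmorph_rho _ _ hrho _ _ chi0.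
    have kE : (kappa rho)%:~R = p%:C%C + q%:C%C :> K[i].
      by rewrite -(rmorphD (real_complex K)) /= pq rmorph_int.
    have NE : (ni_Nz A rho)%:~R = - (p%:C%C * q%:C%C) :> K[i].
      by rewrite -(rmorphM (real_complex K)) /= pqN rmorphN opprK rmorph_int.
    rewrite kE NE => e.
    have -> : forall x y z : K[i], (x - y) * (x - z) = x ^+ 2 - ((y + z) * x - y * z).
      by move=> x y z; ring.
    by rewrite e subrr.
  move/eqP; rewrite mulf_eq0 !subr_eq0 => /orP[]/eqP e; [left|right];
    apply: fr_rmorph_eq => i /=; have [->|ni] := eqVneq i rho;
    by rewrite ?e ?Pr ?Qr // ?Pi ?Qi // chii // rmorph_int.
- by move=> s; rewrite QS FS.
- rewrite Pr Qr; split; congr (_ %:C)%C.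
    by rewrite /d_plus (@FPdim_basis_rmorph _ _ P).
  rewrite /d_minus (@ni_N_Nz _ _ hrho _ P) //.
  (* As [p > 0], [q] is the only negative root, so the default of [xget] is not reached. *)
  apply/esym/classical_sets.xget_unique => [|y [y0 ye]]; first by split=> //; nra.
  have /eqP : (y - p) * (y - q) = 0 by nra.
  by rewrite mulf_eq0 !subr_eq0 => /orP[]/eqP // yp; lra.
Qed.
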